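(* A partial latin square $P$ satisfies Hall's Condition if and only if the Hall Inequality $\sum_{\sigma=1}^n\alpha(\sigma,T)\ge |T|$ holds for every set $T$ of empty cells of $P$.
   Context: A partial latin square of order $n$ is an $n\times n$ array in which some cells are filled with symbols from $\{1,\dots,n\}$, no symbol appearing twice in any row or column. A symbol is missing from a row (column) if it does not appear in a filled cell of that row (column). A cell supports a symbol $\sigma$ if it contains $\sigma$, or it is empty and $\sigma$ is missing from both its row and its column. A set of cells is independent if no two lie in the same row or column; an independent set for $\sigma$ is an independent set all of whose cells support $\sigma$. For a set $T$ of cells, $\alpha(\sigma,T)$ is the maximum size of a subset of $T$ that is an independent set for $\sigma$. $P$ satisfies Hall's Condition if $\sum_{\sigma=1}^n\alpha(\sigma,T)\ge|T|$ for every set $T$ of cells of $P$. *)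

(* Defs.v *)
From mathcomp Require Import all_boot.

Set Implicit Arguments.
Unset Strict Implicit.
Unset Printing Implicit Defensive.

(* Rows, columns and the n symbols are all indexed by 'I_n,
   that is, 0, ..., n-1 stand for 1, ..., n. *)
Notation cell n := ('I_n * 'I_n)%type.

(* P (r, c) = Some s when cell (r, c) is filled with s, None when it is empty. *)
Notation array n := {ffun 'I_n * 'I_n -> option 'I_n}.

Section PartialLatinSquare.

Variable n : nat.
Implicit Types (P : array n) (r c s : 'I_n) (x y : cell n) (S T : {set cell n}).

Definition partial_latin_square P : Prop :=
  (forall r c1 c2 s, P (r, c1) = Some s -> P (r, c2) = Some s -> c1 = c2) /\
  (forall r1 r2 c s, P (r1, c) = Some s -> P (r2, c) = Some s -> r1 = r2).

Definition empty_cell P x : bool := P x == None.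

Definition missing_row P r s : bool := [forall c, P (r, c) != Some s].

Definition missing_col P c s : bool := [forall r, P (r, c) != Some s].

Definition supports P x s : bool :=
  (P x == Some s) ||
  [&& empty_cell P x, missing_row P x.1 s & missing_col P x.2 s].

Definition independent S : bool :=
  [forall x in S, forall y in S, (x != y) ==> (x.1 != y.1) && (x.2 != y.2)].

Definition independent_for P s S : bool :=
  independent S && [forall x in S, supports P x s].

Definition alpha P s T : nat :=
  \max_(S : {set cell n} | (S \subset T) && independent_for P s S) #|S|.

Definition hall_inequality P T : Prop := #|T| <= \sum_(s < n) alpha P s T.

Definition hall_condition P : Prop := forall T, hall_inequality P T.

End PartialLatinSquare.

(* Main.v *)
(** Let [E] and [F] be the empty and the filled cells of [T]. For each symbol
    [s], an independent set for [s] inside [E] can be enlarged by all the cells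
    of [F] filled with [s]: an empty cell supporting [s] shares no row or column
    with a cell containing [s]. Hence the left side of the Hall Inequality grows
    by at least [#|F|] from [E] to [T]. *)
Require Import Defs.
From mathcomp Require Import all_boot.

Section HallOnEmptyCells.

Variables (n : nat) (P : {ffun 'I_n * 'I_n -> option 'I_n}).
Hypothesis hP : partial_latin_square P.
Implicit Types (s : 'I_n) (x y : 'I_n * 'I_n) (S T : {set 'I_n * 'I_n}).

Lemma leq_alpha s S T : S \subset T -> independent_for P s S -> #|S| <= alpha P s T.
Proof.
move=> sST indS.
by apply: (leq_bigmax_cond (P := fun S => _ && _)); rewrite sST.
Qed.

Lemma alpha_attained s T :
  exists S, [/\ S \subset T, independent_for P s S & #|S| = alpha P s T].
Proof.
pose good S := (S \subset T) && independent_for P s S.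
(* The empty set always qualifies, so the maximum runs over a nonempty family and is attained rather
   than being the default value 0. *)
have good0 : 0 < #|good|.
  apply/card_gt0P; exists set0; rewrite unfold_in /good sub0set /=.
  by apply/andP; split; apply/forall_inP => x; rewrite inE.
have [S /andP[sST indS] eqS] := eq_bigmax_cond (fun S => #|S|) good0.
by exists S; split.
Qed.

Lemma filled_disjoint_lines s x y :
  P x = Some s -> P y = Some s -> x != y -> (x.1 != y.1) && (x.2 != y.2).
Proof.
case: hP x y => rowP colP [r1 c1] [r2 c2] /= Px Py; apply: contraNT.
rewrite negb_and !negbK => /orP[] /eqP e; rewrite -{}e in Py *.
  by rewrite (rowP _ _ _ _ Px Py).
by rewrite (colP _ _ _ _ Px Py).
Qed.

(** Being empty, [x] can support [s] only because [s] is missing from its row and its column; a line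
    shared with [y] would contain [s]. *)
Lemma empty_filled_disjoint_lines s x y :
  empty_cell P x -> supports P x s -> P y = Some s ->
  (x.1 != y.1) && (x.2 != y.2).
Proof.
rewrite /empty_cell /supports => /eqP-> /=.
case: x y => [r1 c1] [r2 c2] /= /and3P[_ /forallP rowM /forallP colM] Py.
by apply/andP; split; apply: contraTneq isT => e;
  [have := rowM c2 | have := colM r2]; rewrite e Py eqxx.
Qed.

Definition empty_part T := [set x in T | empty_cell P x].
Definition symbol_part s T := [set x in T | P x == Some s].

Lemma alpha_empty_part s T :
  alpha P s (empty_part T) + #|symbol_part s T| <= alpha P s T.
Proof.
have [S [/subsetP sSE /andP[indS supS] <-]] := alpha_attained s (empty_part T).
move/forall_inP: supS => supS; move/forall_inP: indS => indS.
have emptyS x : x \in S -> empty_cell P x by move/sSE; rewrite inE => /andP[].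
have symP x : x \in symbol_part s T -> P x = Some s.
  by rewrite inE => /andP[_ /eqP].
have disSF : [disjoint S & symbol_part s T].
  apply/pred0P => x /=; apply/andP => -[/emptyS Ex /symP Px].
  by rewrite /empty_cell Px in Ex.
have -> : #|S| + #|symbol_part s T| = #|S :|: symbol_part s T|.
  by apply/esym/eqP; rewrite (leq_card_setU S (symbol_part s T)).2.
apply: leq_alpha.
  by apply/subsetP => x /setUP[/sSE|]; rewrite inE => /andP[].
apply/andP; split; last first.
  apply/forall_inP => x /setUP[/supS //|/symP Px].
  by rewrite /supports Px eqxx.
apply/forall_inP => x Ux; apply/forall_inP => y Uy; apply/implyP => neq_xy.
case/setUP: Ux => [Sx|/symP Px]; case/setUP: Uy => [Sy|/symP Py].
- by move/forall_inP: (indS x Sx) => /(_ y Sy) /implyP/(_ neq_xy).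
- exact: (empty_filled_disjoint_lines _ _ _ (emptyS _ Sx) (supS _ Sx) Py).
(* Here [x] is the filled cell and [y] the empty one, so the roles are swapped by symmetry. *)
- rewrite eq_sym [x.2 == _]eq_sym.
  exact: (empty_filled_disjoint_lines _ _ _ (emptyS _ Sy) (supS _ Sy) Px).
- exact: filled_disjoint_lines Px Py neq_xy.
Qed.

(** Double counting: after exchanging the sums, each cell of [T] counts exactly once, in the empty
    part or in the part of the one symbol it contains. *)
Lemma card_empty_symbol_parts T :
  #|T| = #|empty_part T| + \sum_(s < n) #|symbol_part s T|.
Proof.
have cardE (Q : pred ('I_n * 'I_n)) :
    #|[set x in T | Q x]| = \sum_(x in T) Q x.
  by rewrite -sum1dep_card big_mkcondr; apply: eq_bigr => x _; case: (Q x).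
rewrite cardE -[LHS]sum1_card.
under [X in _ + X]eq_bigr => s _ do rewrite cardE.
rewrite exchange_big -big_split /=; apply: eq_bigr => x _.
rewrite /empty_cell; case: (P x) => [s|] /=; last by rewrite big1.
rewrite (bigD1 s) //= eqxx big1 // => t neq_ts.
by apply/eqP; rewrite eqb0; apply: contraNneq neq_ts => -[->].
Qed.

End HallOnEmptyCells.

Theorem theorem5 (n : nat) (P : {ffun 'I_n * 'I_n -> option 'I_n})
    (hP : partial_latin_square P) :
  hall_condition P <->
  (forall T : {set 'I_n * 'I_n},
     (forall x, x \in T -> empty_cell P x) -> hall_inequality P T).
Proof.
split=> [hall T _ | hallE T]; first exact: hall.
have hE : hall_inequality P (empty_part n P T).
  by apply: hallE => x; rewrite inE => /andP[].
rewrite /hall_inequality (card_empty_symbol_parts n P T).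
apply: (@leq_trans (\sum_(s < n)
  (alpha P s (empty_part n P T) + #|symbol_part n P s T|))).
  (* The total size of the symbol parts occurs on both sides; cancelling it leaves the inequality
     [hE] for the empty part. *)
  by rewrite big_split leq_add2r.
by apply: leq_sum => s _; apply: alpha_empty_part.
Qed.
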